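(* Let $d,n\in\mathbb{N}$. For every $\mu\in\mathcal{M}$ there exists a trigonometric polynomial of best approximation to $\mu$ in the Wasserstein-1 distance, i.e. the infimum of $W_1(p,\mu)$ over all trigonometric polynomials $p$ on $\mathbb{T}^d$ with $\deg(p)\le n$ is attained. Moreover, $$\sup_{\mu\in\mathcal{M}}\ \min_{\deg(p)\le n} W_1(p,\mu)\ \ge\ \frac{1}{4(n+1)}.$$
   Context: $\mathbb{N}=\{1,2,\dots\}$ and $\mathbb{T}^d=[0,1)^d$ is the $d$-dimensional torus (with periodic identification), with wrap-around distance $|x-y|_1=\min_{k\in\mathbb{Z}^d}\|x-y+k\|_1$. $\mathcal{M}$ is the set of all complex Borel measures $\mu$ on $\mathbb{T}^d$ of finite total variation with $\mu(\mathbb{T}^d)=1$. For a function $f:\mathbb{T}^d\to\mathbb{R}$, $\operatorname{Lip}(f)\le 1$ means $|f(x)-f(y)|\le |x-y|_1$ for all $x,y\in\mathbb{T}^d$. The Wasserstein-1 distance is $W_1(\nu,\mu)=\sup_{\operatorname{Lip}(f)\le 1}\left|\int_{\mathbb{T}^d} f\,\mathrm{d}(\nu-\mu)\right|$, and $W_1(p,\mu)$ means $W_1(\nu,\mu)$ with $\mathrm{d}\nu(x)=p(x)\,\mathrm{d}x$ (it is $+\infty$ if $\int_{\mathbb{T}^d} p(x)\,\mathrm{d}x\neq 1$). A trigonometric polynomial $p$ with $\deg(p)\le n$ is a function $p(x)=\sum_{k\in\{-n,\dots,n\}^d} c_k\, e^{2\pi i k x}$, $c_k\in\mathbb{C}$,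 where $kx=k_1x_1+\dots+k_dx_d$. *)

(* Defs.v *)
From HB Require Import structures.
From mathcomp Require Import all_boot all_order all_algebra.
From mathcomp Require Import all_classical all_reals all_analysis.
From mathcomp Require Import measurable_realfun.
From mathcomp Require Import complex.

Set Implicit Arguments.
Unset Strict Implicit.
Unset Printing Implicit Defensive.

Import Order.TTheory GRing.Theory Num.Theory.
Import numFieldNormedType.Exports.

Local Open Scope classical_set_scope.
Local Open Scope ring_scope.
Local Open Scope complex_scope.

Section circle.
Variable R : realType.

Record circle : Type := Circle {
  circle_val : R ;
  circle_valP : (0 <= circle_val) && (circle_val < 1) }.

HB.instance Definition _ := [isSub for circle_val].
HB.instance Definition _ := [Choice of circle by <:].

Let circle0P : ((0 : R) <= 0) && ((0 : R) < 1).
Proof. by rewrite lexx ltr01. Qed.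

HB.instance Definition _ := isPointed.Build circle (Circle circle0P).

(* The trace of the Borel sets of R on [0, 1).  Identifying the end points does
   not change it: these are also the Borel sets for the wrap-around topology. *)
HB.instance Definition _ :=
  Measurable.copy circle (g_sigma_algebra_preimageType circle_val).

Lemma measurable_circle_val : measurable_fun [set: circle] circle_val.
Proof. by move=> _ B mB; exists B. Qed.

Definition circle_lebesgue (A : set circle) : \bar R :=
  lebesgue_measure (circle_val @` A).

Let circle_val_inj : injective circle_val. Proof. exact: val_inj. Qed.

Let circle_val_measurable (A : set circle) :
  measurable A -> measurable (circle_val @` A).
Proof.
move=> [B mB <-]; rewrite setTI.
suff -> : circle_val @` (circle_val @^-1` B) = B `&` `[0, 1[%classic.
  exact: measurableI.
apply/seteqP; split => [_ [x Bx <-]|r [Br]].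
  by split => //=; rewrite in_itv/=; exact: circle_valP.
by rewrite /= in_itv/= => r01; exists (Circle r01).
Qed.

Let circle_lebesgue0 : circle_lebesgue set0 = 0%E.
Proof. by rewrite /circle_lebesgue image_set0 measure0. Qed.

Let circle_lebesgue_ge0 A : (0 <= circle_lebesgue A)%E.
Proof. exact: measure_ge0. Qed.

Let circle_lebesgue_sigma_additive : semi_sigma_additive circle_lebesgue.
Proof.
move=> F mF tF mUF; rewrite /circle_lebesgue image_bigcup.
apply: measure_semi_sigma_additive.
- by move=> n; exact: circle_val_measurable.
- apply/trivIsetP => i j _ _ ij; move/trivIsetP : tF => /(_ _ _ I I ij) Fij.
  apply/seteqP; split => // _ [[x Fix <-] [y Fjy /circle_val_inj yx]].
  have : (F i `&` F j) x by split => //; rewrite -yx.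
  by rewrite Fij.
- by rewrite -image_bigcup; exact: circle_val_measurable.
Qed.

HB.instance Definition _ := isMeasure.Build _ _ _ circle_lebesgue
  circle_lebesgue0 circle_lebesgue_ge0 circle_lebesgue_sigma_additive.

Let circle_lebesgueT : circle_lebesgue setT = 1%E.
Proof.
rewrite /circle_lebesgue.
have -> : circle_val @` setT = `[0, 1[%classic.
  apply/seteqP; split => [_ [x _ <-]|r /=].
    by rewrite /= in_itv/=; exact: circle_valP.
  by rewrite in_itv/= => r01; exists (Circle r01).
by rewrite lebesgue_measure_itv/= lte_fin ltr01 sube0.
Qed.

HB.instance Definition _ :=
  Measure_isProbability.Build _ _ _ circle_lebesgue circle_lebesgueT.

End circle.

Section torus.
Variable R : realType.

(* [d.-tuple (circle R)] carries the product sigma-algebra, which is the Borel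
   sigma-algebra of the product topology since the circle is second countable. *)
Definition torus (d : nat) : Type := d.-tuple (circle R).

HB.instance Definition _ d := Measurable.on (torus d).

Definition torus_coord (d : nat) (x : torus d) (j : 'I_d) : R := circle_val (tnth x j).

Lemma measurable_torus_coord d (j : 'I_d) :
  measurable_fun [set: torus d] (fun x => torus_coord x j).
Proof.
apply: (@measurableT_comp _ _ _ _ _ _ (@circle_val R)).
  exact: measurable_circle_val.
exact: measurable_tnth.
Qed.

Definition torus_cons d (z : circle R * torus d) : torus d.+1 :=
  [tuple of z.1 :: z.2].

Let measurable_torus_cons d : measurable_fun setT (@torus_cons d).
Proof. exact: measurable_cons. Qed.

HB.instance Definition _ d :=
  @isMeasurableFun.Build _ _ _ _ (@torus_cons d) (@measurable_torus_cons d).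

Fixpoint torus_lebesgue (d : nat) : probability (torus d) R :=
  match d with
  | 0 => \d_([tuple] : torus 0)
  | d.+1 => distribution (@circle_lebesgue R \x torus_lebesgue d)%E
              (@torus_cons d)
  end.

Definition torus_dist d (x y : torus d) : R :=
  inf [set \sum_(j < d) `|torus_coord x j - torus_coord y j + (k j)%:~R|
      | k in [set: 'I_d -> int]].

Definition lip1 d (f : torus d -> R) : Prop :=
  forall x y, `|f x - f y| <= torus_dist x y.

End torus.

Section charge_integral.
Context d (T : measurableType d) (R : realType).
Implicit Types (nu : {charge set T -> \bar R}) (f : T -> R).

Lemma Hahn_sets nu :
  {PN : set T * set T | hahn_decomposition nu PN.1 PN.2}.
Proof.
by apply: cid; have [P [N PN]] := Hahn_decomposition nu; exists (P, N).
Qed.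

Definition charge_integral nu f : R :=
  let nuPN := svalP (Hahn_sets nu) in
  Rintegral (jordan_pos nuPN) setT f - Rintegral (jordan_neg nuPN) setT f.

End charge_integral.

Section complex_measure.
Context d (T : measurableType d) (R : realType).

(* Complex measures are encoded by their real and imaginary parts, which are
   finite signed measures. *)
Record complex_measure : Type := ComplexMeasure {
  cmeasure_Re : {charge set T -> \bar R} ;
  cmeasure_Im : {charge set T -> \bar R} }.

Implicit Types mu nu : complex_measure.

Definition cmeasure_val mu (A : set T) : R[i] :=
  fine (cmeasure_Re mu A) +i* fine (cmeasure_Im mu A).

Coercion cmeasure_val : complex_measure >-> Funclass.

Definition cmeasure_sub nu mu : complex_measure :=
  ComplexMeasure (cadd (cmeasure_Re nu) (cscale (-1) (cmeasure_Re mu)))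
                 (cadd (cmeasure_Im nu) (cscale (-1) (cmeasure_Im mu))).

Definition total_variation mu : \bar R :=
  ereal_sup [set x : \bar R | exists (m : nat) (F : 'I_m -> set T),
    [/\ forall i, measurable (F i), trivIset setT F, \bigcup_i F i = setT &
        x = (\sum_(i < m) Normc.normc (mu (F i)))%:E]].

Definition cmeasure_integral mu (f : T -> R) : R[i] :=
  charge_integral (cmeasure_Re mu) f +i* charge_integral (cmeasure_Im mu) f.

Definition density_measure (la : {measure set T -> \bar R}) (p : T -> R[i])
    (intRe : la.-integrable setT (fun x => (complex.Re (p x))%:E))
    (intIm : la.-integrable setT (fun x => (complex.Im (p x))%:E)) : complex_measure :=
  ComplexMeasure (induced_charge intRe) (induced_charge intIm).

End complex_measure.

Section wasserstein.
Variables (R : realType) (d : nat).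

Definition normalized_cmeasures : set (complex_measure (torus R d) R) :=
  [set mu | (total_variation mu < +oo)%E /\ mu setT = 1].

Definition W1 (nu mu : complex_measure (torus R d) R) : \bar R :=
  ereal_sup [set (Normc.normc (cmeasure_integral (cmeasure_sub nu mu) f))%:E
            | f in [set f | lip1 f]].

End wasserstein.

Section trigonometric_polynomials.
Variables (R : realType) (d n : nat).

(* [k : trig_index] stands for the frequency vector in {-n, ..., n}^d whose
   [j]-th component is [freq k j]. *)
Definition trig_index : finType := {ffun 'I_d -> 'I_(n.*2.+1)}.

Definition freq (k : trig_index) (j : 'I_d) : int := (k j)%:Z - n%:Z.

Definition cexpi (t : R) : R[i] := cos t +i* sin t.

Definition phase (k : trig_index) (x : torus R d) : R :=
  2 * pi * \sum_(j < d) (freq k j)%:~R * torus_coord x j.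

(* Trigonometric polynomials of degree at most [n], given by coefficients. *)
Definition trigpoly : Type := {ffun trig_index -> R[i]}.

Definition trigpoly_fun (p : trigpoly) (x : torus R d) : R[i] :=
  \sum_(k : trig_index) p k * cexpi (phase k x).

Lemma Re_trigpoly (p : trigpoly) x : complex.Re (trigpoly_fun p x) =
  \sum_(k : trig_index)
    (complex.Re (p k) * cos (phase k x) - complex.Im (p k) * sin (phase k x)).
Proof.
rewrite /trigpoly_fun; elim/big_rec2 : _ => //= k a z _ <-.
by case: (p k) z => [u v] [z1 z2].
Qed.

Lemma Im_trigpoly (p : trigpoly) x : complex.Im (trigpoly_fun p x) =
  \sum_(k : trig_index)
    (complex.Re (p k) * sin (phase k x) + complex.Im (p k) * cos (phase k x)).
Proof.
rewrite /trigpoly_fun; elim/big_rec2 : _ => //= k a z _ <-.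
by case: (p k) z => [u v] [z1 z2].
Qed.

Lemma measurable_phase k : measurable_fun [set: torus R d] (phase k).
Proof.
apply: measurable_funM => //.
apply: measurable_sum => j; apply: measurable_funM => //.
exact: measurable_torus_coord.
Qed.

Lemma measurable_cos_phase k :
  measurable_fun [set: torus R d] (fun x => cos (phase k x)).
Proof.
apply: measurableT_comp (measurable_phase k).
by apply: continuous_measurable_fun; exact: continuous_cos.
Qed.

Lemma measurable_sin_phase k :
  measurable_fun [set: torus R d] (fun x => sin (phase k x)).
Proof.
apply: measurableT_comp (measurable_phase k).
by apply: continuous_measurable_fun; exact: continuous_sin.
Qed.

Lemma trigpoly_Re_integrable (p : trigpoly) :
  (torus_lebesgue R d).-integrable setT (fun x => (complex.Re (trigpoly_fun p x))%:E).
Proof.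
apply: measurable_bounded_integrable => //.
- by rewrite [ltLHS]probability_setT ltry.
- apply: (eq_measurable_fun _ (fun x _ => esym (Re_trigpoly p x))).
  apply: measurable_sum => k; apply: measurable_funB; apply: measurable_funM.
  + exact: measurable_cst.
  + exact: measurable_cos_phase.
  + exact: measurable_cst.
  + exact: measurable_sin_phase.
- exists (\sum_(k : trig_index) (`|complex.Re (p k)| + `|complex.Im (p k)|)).
  split; first by rewrite num_real.
  move=> M /ltW pM x _ /=; apply: le_trans pM.
  rewrite Re_trigpoly; apply: le_trans (ler_norm_sum _ _ _) _.
  apply: ler_sum => k _; apply: le_trans (ler_normB _ _) _.
  by rewrite !normrM lerD// ler_piMr// ler_norml ?cos_geN1 ?cos_le1 ?sin_geN1 ?sin_le1.
Qed.

Lemma trigpoly_Im_integrable (p : trigpoly) :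
  (torus_lebesgue R d).-integrable setT (fun x => (complex.Im (trigpoly_fun p x))%:E).
Proof.
apply: measurable_bounded_integrable => //.
- by rewrite [ltLHS]probability_setT ltry.
- apply: (eq_measurable_fun _ (fun x _ => esym (Im_trigpoly p x))).
  apply: measurable_sum => k; apply: measurable_funD; apply: measurable_funM.
  + exact: measurable_cst.
  + exact: measurable_sin_phase.
  + exact: measurable_cst.
  + exact: measurable_cos_phase.
- exists (\sum_(k : trig_index) (`|complex.Re (p k)| + `|complex.Im (p k)|)).
  split; first by rewrite num_real.
  move=> M /ltW pM x _ /=; apply: le_trans pM.
  rewrite Im_trigpoly; apply: le_trans (ler_norm_sum _ _ _) _.
  apply: ler_sum => k _; apply: le_trans (ler_normD _ _) _.
  by rewrite !normrM lerD// ler_piMr// ler_norml ?cos_geN1 ?cos_le1 ?sin_geN1 ?sin_le1.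
Qed.

Definition trigpoly_measure (p : trigpoly) : complex_measure (torus R d) R :=
  density_measure (trigpoly_Re_integrable p) (trigpoly_Im_integrable p).

(* No case distinction on the integral of [p] is needed: constants are
   1-Lipschitz, so the supremum in [W1] is +oo as soon as the two total masses
   differ. *)
Definition W1_trigpoly (p : trigpoly) (mu : complex_measure (torus R d) R) :
    \bar R :=
  W1 (trigpoly_measure p) mu.

Definition W1_inf (mu : complex_measure (torus R d) R) : \bar R :=
  ereal_inf [set W1_trigpoly p mu | p in [set: trigpoly]].

End trigonometric_polynomials.

Arguments W1_inf {R d} n mu.

(* Main.v *)
(* Existence.  For fixed Lipschitz [f], the integral of [f] against [p dx - mu]
   is affine in the coefficients of [p], so [p |-> W1(p, mu)] is a supremum of
   continuous functions.  Its sublevel sets are bounded: the k-th coefficient is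
   recovered by testing against cos(2 pi k x) and sin(2 pi k x), which are
   Lipschitz up to a factor 2 pi n.  A cluster point of a minimizing sequence is
   therefore a minimizer.

   Lower bound.  Put N = n + 1.  The tent function f(x) = (1/4 - dist(N x_1, Z)) / N
   is 1-Lipschitz and changes sign under translation of x_1 by 1/(2N), while
   exp(2 pi i k x) is multiplied by exp(i pi k_1 / N), which is not -1 when
   |k_1| <= n.  Hence f is orthogonal to all polynomials of degree at most n, and
   W1(p, delta_0) >= |f(0)| = 1/(4N) for every such p. *)

Require Import Defs.
From HB Require Import structures.
From mathcomp Require Import all_boot all_order all_algebra.
From mathcomp Require Import all_classical all_reals all_analysis.
From mathcomp Require Import complex.
From mathcomp Require Import measurable_realfun ring lra zify.

Set Implicit Arguments.
Unset Strict Implicit.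
Unset Printing Implicit Defensive.

Import Order.TTheory GRing.Theory Num.Theory.
Import numFieldNormedType.Exports.

Local Open Scope classical_set_scope.
Local Open Scope ring_scope.

(** * Functionals on bounded measurable functions, determined by indicators *)

Section bounded_measurable.
Context d (T : measurableType d) (R : realType).
Implicit Types (f g : T -> R) (A : set T).

Definition bounded_measurable f :=
  measurable_fun [set: T] f /\ exists B, forall x, `|f x| <= B.

Lemma bounded_measurable_cst c : bounded_measurable (fun=> c).
Proof. by split; [exact: measurable_cst|exists `|c|]. Qed.

Lemma bounded_measurable_indic A : measurable A -> bounded_measurable (\1_A).
Proof.
move=> mA; split; first exact: measurable_indic.
by exists 1 => x; rewrite indicE; case: (x \in A); rewrite ?normr1 ?normr0.
Qed.

Lemma bounded_measurableD f g : bounded_measurable f -> bounded_measurable g ->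
  bounded_measurable (fun x => f x + g x).
Proof.
move=> [mf [B fB]] [mg [C gC]]; split; first exact: measurable_funD.
by exists (B + C) => x; apply: le_trans (ler_normD _ _) _; rewrite lerD.
Qed.

Lemma bounded_measurableM f g : bounded_measurable f -> bounded_measurable g ->
  bounded_measurable (fun x => f x * g x).
Proof.
move=> [mf [B fB]] [mg [C gC]]; split; first exact: measurable_funM.
by exists (B * C) => x; rewrite normrM ler_pM.
Qed.

Lemma bounded_measurableZ c f : bounded_measurable f ->
  bounded_measurable (fun x => c * f x).
Proof. by apply: bounded_measurableM; exact: bounded_measurable_cst. Qed.

Lemma bounded_measurableB f g : bounded_measurable f -> bounded_measurable g ->
  bounded_measurable (fun x => f x - g x).
Proof.
move=> bf bg; under [X in bounded_measurable X]eq_fun do rewrite -mulN1r.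
by apply: bounded_measurableD => //; exact: bounded_measurableZ.
Qed.

Lemma bounded_measurable_sum (I : Type) (s : seq I) (h : I -> T -> R) :
  (forall i, bounded_measurable (h i)) ->
  bounded_measurable (fun x => \sum_(i <- s) h i x).
Proof.
move=> bh; elim: s => [|i s IH].
  under [X in bounded_measurable X]eq_fun do rewrite big_nil.
  exact: bounded_measurable_cst.
under [X in bounded_measurable X]eq_fun do rewrite big_cons.
exact: bounded_measurableD.
Qed.

Lemma bounded_measurable_integrable (m : {measure set T -> \bar R}) f :
  (m setT < +oo)%E -> bounded_measurable f -> m.-integrable setT (EFin \o f).
Proof.
move=> moo [mf [B fB]]; apply: measurable_bounded_integrable => //.
exists B; split; first by rewrite num_real.
by move=> M BM x _ /=; exact: le_trans (fB x) (ltW BM).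
Qed.

(** Linear and continuous for the sup norm: the common shape of integrals against measures, charges
    and densities, so that one extension principle serves them all. *)
Definition bounded_functional (Phi : (T -> R) -> R) :=
  (forall a f g, bounded_measurable f -> bounded_measurable g ->
     Phi (fun x => a * f x + g x) = a * Phi f + Phi g) /\
  (exists K, forall f c, bounded_measurable f -> (forall x, `|f x| <= c) ->
     `|Phi f| <= K * c).

Lemma bounded_functional_sub Phi Psi : bounded_functional Phi ->
  bounded_functional Psi -> bounded_functional (fun f => Phi f - Psi f).
Proof.
move=> [lPhi [K bPhi]] [lPsi [L bPsi]]; split.
  by move=> a f g bf bg; rewrite lPhi// lPsi//; ring.
exists (K + L) => f c bf fc; rewrite mulrDl.
by apply: le_trans (ler_normB _ _) _; rewrite lerD ?bPhi ?bPsi.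
Qed.

Lemma bounded_functional_Rintegral (m : {measure set T -> \bar R}) :
  (m setT < +oo)%E -> bounded_functional (Rintegral m setT).
Proof.
move=> moo; split.
  move=> a f g bf bg.
  rewrite RintegralD ?RintegralZl//; exact: bounded_measurable_integrable
    (bounded_measurableZ _ _) || exact: bounded_measurable_integrable.
exists (fine (m setT)) => f c bf fc.
have bnf : bounded_measurable (fun x => `|f x|).
  case: bf => [mf [B fB]]; split; first exact: measurableT_comp.
  by exists B => x; rewrite normr_id.
apply: le_trans (le_normr_Rintegral _ _) _ => //.
  exact: bounded_measurable_integrable.
rewrite mulrC -Rintegral_cst//; apply: le_Rintegral => //.
- exact: bounded_measurable_integrable.
- exact: bounded_measurable_integrable (bounded_measurable_cst _).
Qed.

Lemma bounded_functional0 Phi : bounded_functional Phi -> Phi (fun=> 0) = 0.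
Proof.
move=> [lPhi _]; have b0 := bounded_measurable_cst 0.
have := lPhi (-1) _ _ b0 b0; under eq_fun do rewrite mulr0 addr0.
by move=> ->; ring.
Qed.

Lemma bounded_functional_comb Phi : bounded_functional Phi ->
  forall a b f g, bounded_measurable f -> bounded_measurable g ->
  Phi (fun x => a * f x + b * g x) = a * Phi f + b * Phi g.
Proof.
move=> bPhi a b f g bf bg; rewrite bPhi.1//; last exact: bounded_measurableZ.
have := bPhi.1 b g (fun=> 0) bg (bounded_measurable_cst 0).
by rewrite bounded_functional0// addr0 => <-; under [in RHS]eq_fun do rewrite addr0.
Qed.

Lemma bounded_functional_sum Phi (I : Type) (s : seq I) (c : I -> R)
    (h : I -> T -> R) : bounded_functional Phi ->
  (forall i, bounded_measurable (h i)) ->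
  Phi (fun x => \sum_(i <- s) c i * h i x) = \sum_(i <- s) c i * Phi (h i).
Proof.
move=> bPhi bh; elim: s => [|i s IH].
  by under eq_fun do rewrite big_nil; rewrite big_nil bounded_functional0.
under eq_fun do rewrite big_cons.
rewrite big_cons bPhi.1 ?IH//; apply: bounded_measurable_sum => j.
exact: bounded_measurableZ.
Qed.

(* Slicing the range of [f] at the multiples of 1/m approximates [f] uniformly
   by finite combinations of indicators. *)
Lemma bounded_measurable_approx f (m : nat) : (0 < m)%N -> bounded_measurable f ->
  exists (N : nat) (c : 'I_N -> R) (A : 'I_N -> set T),
    (forall i, measurable (A i)) /\
    forall x, `|f x - \sum_(i < N) c i * \1_(A i) x| <= m%:R^-1.
Proof.
move=> m0 [mf [B fB]].
have m0' : 0 < m%:R :> R by rewrite ltr0n.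
(* Shifting by [B] and scaling by [m] turns the slices into intervals [[i, i+1)] with [i] natural;
   the bound [g x <= m * (B + B)] dictates their number [N]. *)
pose g x := m%:R * (f x + B).
have g0 x : 0 <= g x.
  by rewrite mulr_ge0 ?ler0n//; move: (fB x); rewrite ler_norml => /andP[]; lra.
pose N := (Num.trunc (m%:R * (B + B))).+1.
exists N, (fun i => i%:R / m%:R - B), (fun i => g @^-1` `[i%:R, i.+1%:R[%classic).
split.
  move=> i; rewrite -[X in measurable X]setTI.
  have mg : measurable_fun setT g.
    by apply: measurable_funM => //; exact: measurable_funD.
  by apply: mg => //; exact: measurable_itv.
move=> x; have /andP[g1 g2] := truncn_itv (g0 x).
have kN : (Num.trunc (g x) < N)%N.
  rewrite ltnS; apply: le_truncn; rewrite /g ler_pM2l// lerD2r.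
  exact: le_trans (ler_norm _) (fB x).
(* The slices are disjoint, so only the one indexed by the integer part of [g x] contributes. *)
rewrite (bigD1 (Ordinal kN))//= big1 ?addr0; last first.
  move=> i /eqP iN; rewrite indicE memNset ?mulr0//= in_itv/= => /andP[i1 i2].
  apply: iN; apply: val_inj => /=; apply/eqP; rewrite eqn_leq.
  by rewrite -ltnS -[X in _ && X]ltnS -!(ltr_nat R) (le_lt_trans i1)// (le_lt_trans g1).
rewrite indicE mem_set/= ?in_itv/= ?g1// mulr1.
set k := Num.trunc (g x) in g1 g2 *.
have -> : f x - (k%:R / m%:R - B) = (g x - k%:R) / m%:R.
  by rewrite /g; field; rewrite gt_eqF.
rewrite normrM normfV ger0_norm ?subr_ge0// (ger0_norm (ltW m0')).
rewrite ler_piMl ?invr_ge0 ?(ltW m0')//.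
by move: g2; rewrite -natr1; lra.
Qed.

(** The difference of the two functionals vanishes on simple functions, and these approximate [f]
    uniformly within [1/m]; hence its value at [f] is at most [K/m] for every [m > 0]. *)
Lemma bounded_functional_ext Phi Psi :
  bounded_functional Phi -> bounded_functional Psi ->
  (forall A, measurable A -> Phi (\1_A) = Psi (\1_A)) ->
  forall f, bounded_measurable f -> Phi f = Psi f.
Proof.
move=> bPhi bPsi PhiPsi f bf; apply/eqP; rewrite -subr_eq0 -normr_eq0.
have := bounded_functional_sub bPhi bPsi; set D := (fun f => _) => bD.
have [lD [K KD]] := bD.
have small (m : nat) : (0 < m)%N -> `|D f| <= K * m%:R^-1.
  move=> m0; have [N [c [A [mA fcA]]]] := bounded_measurable_approx m0 bf.
  pose s x := \sum_(i < N) c i * \1_(A i) x.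
  have bs : bounded_measurable s.
    apply: bounded_measurable_sum => i; apply: bounded_measurableZ.
    exact: bounded_measurable_indic.
  have Ds : D s = 0.
    rewrite /s bounded_functional_sum//; last by move=> i; exact: bounded_measurable_indic.
    by rewrite big1// => i _; rewrite /D PhiPsi// subrr mulr0.
  have -> : D f = D (fun x => f x - s x).
    have := lD (-1) _ _ bs bf; rewrite Ds mulr0 add0r => <-.
    by congr D; apply/funext => x; rewrite mulN1r addrC.
  by apply: KD => //; exact: bounded_measurableB.
rewrite eq_le normr_ge0 andbT -/(D f) leNgt; apply/negP => Df0.
(* The case [m = 1] yields the sign of [K]; an [m] above [K / |D f|] then gives the
   contradiction. *)
have K0 : 0 <= K.
  by have := le_trans (ltW Df0) (small 1%N isT); rewrite invr1 mulr1.
have := small (Num.trunc (K / `|D f|)).+1 isT.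
rewrite leNgt => /negP; apply; rewrite ltr_pdivrMr ?ltr0n// mulrC -ltr_pdivrMr//.
by have /andP[] := truncn_itv (divr_ge0 K0 (ltW Df0)).
Qed.

End bounded_measurable.

(** * Integrals against charges and complex measures *)

Section charge_integral_functional.
Context d (T : measurableType d) (R : realType).
Implicit Types (nu : {charge set T -> \bar R}) (f g : T -> R).

Lemma Rintegral_indic (m : {measure set T -> \bar R}) A : measurable A ->
  Rintegral m setT (\1_A) = fine (m A).
Proof. by move=> mA; rewrite /Rintegral integral_indic// setIT. Qed.

Lemma bounded_functional_charge_integral nu :
  bounded_functional (charge_integral nu).
Proof.
apply: bounded_functional_sub; apply: bounded_functional_Rintegral;
  by rewrite ltey_eq fin_num_measure.
Qed.

(** The Jordan decomposition gives this for any choice of Hahn sets. Together with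
    [bounded_functional_ext] it determines the integral of every bounded measurable function
    independently of that choice. *)
Lemma charge_integral_indic nu A : measurable A ->
  charge_integral nu (\1_A) = fine (nu A).
Proof.
move=> mA; rewrite /charge_integral !Rintegral_indic//.
rewrite (jordan_decomp (svalP (Hahn_sets nu)) mA) /cadd/= cscaleN1.
by rewrite fineB ?fin_num_measure.
Qed.

(** The Jordan parts of a difference are in general not the differences of the Jordan parts, so both
    sides are compared on indicators. *)
Lemma charge_integral_sub (a b : {charge set T -> \bar R}) f :
  bounded_measurable f ->
  charge_integral (cadd a (cscale (-1) b)) f =
  charge_integral a f - charge_integral b f.
Proof.
move: f; apply: bounded_functional_ext.
- exact: bounded_functional_charge_integral.
- by apply: bounded_functional_sub; exact: bounded_functional_charge_integral.
move=> A mA; rewrite !charge_integral_indic// -fineB ?fin_num_measure//; congr fine.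
by rewrite -[LHS]/(a A + (-1)%:E * b A)%E EFinN mulN1e.
Qed.

Lemma bounded_functional_density (m : {measure set T -> \bar R}) g :
  (m setT < +oo)%E -> bounded_measurable g ->
  bounded_functional (fun f => Rintegral m setT (fun x => f x * g x)).
Proof.
move=> moo bg; have [lm [K Km]] := bounded_functional_Rintegral moo.
split.
  move=> a f h bf bh; rewrite -lm; last 2 first.
  - exact: bounded_measurableM.
  - exact: bounded_measurableM.
  by congr Rintegral; apply/funext => x; ring.
have [B gB] := bg.2; exists (K * B) => f c bf fc; rewrite -mulrA [B * c]mulrC.
apply: Km; first exact: bounded_measurableM.
by move=> x; rewrite normrM ler_pM.
Qed.

(** Both sides are bounded functionals of [f], and on an indicator each is the integral of [g] over
    the set. *)
Lemma charge_integral_induced (m : {measure set T -> \bar R}) g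
    (ig : m.-integrable setT (fun x => (g x)%:E)) f :
  (m setT < +oo)%E -> bounded_measurable g -> bounded_measurable f ->
  charge_integral (induced_charge ig) f = Rintegral m setT (fun x => f x * g x).
Proof.
move=> moo bg; move: f; apply: bounded_functional_ext.
- exact: bounded_functional_charge_integral.
- exact: bounded_functional_density.
move=> A mA; rewrite charge_integral_indic// /induced_charge/=.
rewrite -/(Rintegral m A g) Rintegral_mkcond; apply: eq_Rintegral => x _.
by rewrite patchE indicE; case: ifP; rewrite (mul1r, mul0r).
Qed.

Lemma cmeasure_integral_sub (nu mu : complex_measure T R) f :
  bounded_measurable f ->
  cmeasure_integral (cmeasure_sub nu mu) f =
  cmeasure_integral nu f - cmeasure_integral mu f.
Proof. by move=> bf; rewrite /cmeasure_integral/= !charge_integral_sub. Qed.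

End charge_integral_functional.

(** * Translation invariance of Lebesgue measure on the torus *)

Section torus_translation.
Variable R : realType.

Definition preserves d (T : measurableType d) (m : set T -> \bar R) (s : T -> T) :=
  measurable_fun [set: T] s /\ forall A, measurable A -> m (s @^-1` A) = m A.

Lemma Rintegral_preserves d (T : measurableType d)
    (m : {measure set T -> \bar R}) (s : T -> T) f :
  (m setT < +oo)%E -> preserves m s -> bounded_measurable f ->
  Rintegral m setT (fun x => f (s x)) = Rintegral m setT f.
Proof.
move=> moo [ms sm]; move: f; have [lm [K Km]] := bounded_functional_Rintegral moo.
have bs f : bounded_measurable f -> bounded_measurable (fun x => f (s x)).
  move=> [mf [B fB]]; split; first exact: measurableT_comp.
  by exists B => x.
apply: bounded_functional_ext.
- split; first by move=> a f g bf bg; rewrite -lm//; exact: bs.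
  by exists K => f c bf fc; apply: Km => //; exact: bs.
- exact: bounded_functional_Rintegral.
move=> A mA; rewrite -[X in Rintegral _ _ X]/(\1_(s @^-1` A)) ?Rintegral_indic ?sm//.
by rewrite -[X in measurable X]setTI; exact: ms.
Qed.

(** The image of the product measure agrees with it on measurable rectangles, which characterise
    it. *)
Lemma preserves_prod d1 d2 (T1 : measurableType d1) (T2 : measurableType d2)
    (m1 : {sigma_finite_measure set T1 -> \bar R})
    (m2 : {sigma_finite_measure set T2 -> \bar R}) s1 s2 :
  preserves m1 s1 -> preserves m2 s2 ->
  preserves (m1 \x m2)%E (fun z => (s1 z.1, s2 z.2)).
Proof.
move=> [ms1 s1P] [ms2 s2P].
have ms : measurable_fun setT (fun z : T1 * T2 => (s1 z.1, s2 z.2)).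
  apply: measurable_fun_pair.
    exact: (measurableT_comp ms1 measurable_fst).
  exact: (measurableT_comp ms2 measurable_snd).
split=> // A mA.
pose m' : {measure set (T1 * T2) -> \bar R} :=
  pushforward (m1 \x m2)%E (fun z : T1 * T2 => (s1 z.1, s2 z.2)).
rewrite -[LHS]/(m' ms A); apply/esym; apply: product_measure_unique => //.
move=> B C mB mC; rewrite /m'/= /pushforward.
rewrite -(s1P _ mB) -(s2P _ mC) -product_measure1E//.
- by rewrite -[X in measurable X]setTI; exact: ms1.
- by rewrite -[X in measurable X]setTI; exact: ms2.
Qed.


(** The image measure gives half-open intervals their length, so uniqueness of Lebesgue measure
    applies. *)
Lemma lebesgue_measure_translation (c : R) : preserves lebesgue_measure (+%R^~ c).
Proof.
have mc : measurable_fun [set: measurableTypeR R] (fun x : measurableTypeR R => x + c).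
  by apply: measurable_funD => //; exact: measurable_cst.
split => // A mA.
pose m' : {measure set (measurableTypeR R) -> \bar R} :=
  @pushforward _ _ (measurableTypeR R) (measurableTypeR R) _ (@lebesgue_measure R)
    (fun x => x + c).
rewrite -[LHS]/(m' mc A); apply/esym/lebesgue_measure_unique => // _ [[a b] _ <-].
rewrite /m'/= /pushforward.
have -> : (fun x : R => x + c) @^-1` `]a, b]%classic = `]a - c, b - c]%classic.
  by apply/seteqP; split => x /=; rewrite !in_itv/= ltrBlDr lerBrDr.
rewrite /= !lebesgue_measure_itv/= !lte_fin ltrD2r.
by case: ifP => // _; rewrite -!EFinB; congr EFin; ring.
Qed.

Lemma circle_add_subproof (h a : circle R) :
  let s := circle_val a + circle_val h in
  let r := if s < 1 then s else s - 1 in (0 <= r) && (r < 1).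
Proof.
move: (circle_valP h) (circle_valP a) => /andP[h0 h1] /andP[a0 a1] /=.
by case: ltP => ah; lra.
Qed.

Definition circle_add (h a : circle R) : circle R := Circle (circle_add_subproof h a).

Lemma circle_addE (h a : circle R) : exists k : int,
  circle_val (circle_add h a) = circle_val a + circle_val h + k%:~R.
Proof.
rewrite /circle_add/=; case: ltP => _; first by exists 0; rewrite addr0.
by exists (-1); rewrite mulrN1z.
Qed.

(** A value in [[h, 1)] is reached without wrapping around, a value in [[0, h)] after subtracting 1.
    Cutting the target at [h] thus makes the preimage a disjoint union of two translates on the real
    line. *)
Lemma preserves_circle_add (h : circle R) :
  preserves (@circle_lebesgue R) (circle_add h).
Proof.
have /andP[h0 h1] := circle_valP h.
have mh : measurable_fun setT (circle_add h).
  have mD : measurable_fun setT (fun a : circle R => circle_val a + circle_val h).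
    by apply: measurable_funD => //; exact: measurable_circle_val.
  have mval : measurable_fun setT (@circle_val R \o circle_add h).
    apply: measurable_fun_ifT => //; first exact: measurable_fun_ltr.
    exact: measurable_funB.
  move=> _ _ [B mB <-]; rewrite [X in _ `&` _ @^-1` X]setTI -comp_preimage.
  exact: mval.
split=> // _ [B mB <-]; rewrite setTI /circle_lebesgue.
have valE : @circle_val R @` (@circle_val R @^-1` B) =
    (B `&` `[circle_val h, 1[) `|` (B `&` `[0, circle_val h[).
  apply/seteqP; split => [_ [x Bx <-]|r [|] [Br]] /=.
  - have /andP[x0 x1] := circle_valP x; rewrite !in_itv/= x0 x1 andbT.
    by case: (leP (circle_val h) (circle_val x)); [left|right].
  - rewrite in_itv/= => /andP[r0 r1].
    have r01 : (0 <= r) && (r < 1) by lra.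
    by exists (Circle r01).
  - rewrite in_itv/= => /andP[r0 r1].
    have r01 : (0 <= r) && (r < 1) by lra.
    by exists (Circle r01).
have addE : @circle_val R @` (circle_add h @^-1` (@circle_val R @^-1` B)) =
    (+%R^~ (circle_val h)) @^-1` (B `&` `[circle_val h, 1[) `|`
    (+%R^~ (circle_val h - 1)) @^-1` (B `&` `[0, circle_val h[).
  apply/seteqP; split => [_ [x Bx <-]|r [|] [Br]] /=.
  - move: Bx; have /andP[x0 x1] := circle_valP x; rewrite /= !in_itv/= addrA.
    by case: ltP => xh Bx; [left|right]; split => //; lra.
  - rewrite in_itv/= => /andP[r0 r1].
    have r01 : (0 <= r) && (r < 1) by lra.
    by exists (Circle r01) => //=; rewrite r1.
  - rewrite in_itv/= => /andP[r0 r1].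
    have r01 : (0 <= r) && (r < 1) by lra.
    exists (Circle r01) => //=; rewrite ltNge.
    have -> : (1 <= r + circle_val h) by lra.
    by rewrite /= -addrA.
have m1 : measurable (B `&` `[circle_val h, 1[) by exact: measurableI.
have m2 : measurable (B `&` `[0, circle_val h[) by exact: measurableI.
have t (c : R) (A : set R) : measurable A ->
    measurable ((+%R^~ c) @^-1` A).
  move=> mA; rewrite -[X in measurable X]setTI.
  exact: (lebesgue_measure_translation c).1.
have U (X Y : set R) : measurable X -> measurable Y -> X `&` Y = set0 ->
    lebesgue_measure (X `|` Y) = (lebesgue_measure X + lebesgue_measure Y)%E.
  move=> mX mY XY; exact: (@measureU _ R (measurableTypeR R) (@lebesgue_measure R) X Y mX mY XY).
rewrite valE addE U//.
- rewrite U//; last first.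
    apply/seteqP; split => // r [[_ /=]]; rewrite in_itv/= => /andP[r0 r1].
    by move=> [_]; rewrite in_itv/= => /andP[r2 r3]; lra.
  by congr (_ + _)%E; exact: (lebesgue_measure_translation _).2.
- exact: t.
- exact: t.
- apply/seteqP; split => // r [[_ /=]]; rewrite in_itv/= => /andP[r0 r1].
  by move=> [_]; rewrite in_itv/= => /andP[r2 r3]; lra.
Qed.

Definition torus_add d (h x : torus R d) : torus R d :=
  [tuple circle_add (tnth h i) (tnth x i) | i < d].

Lemma torus_coord_add d (h x : torus R d) (j : 'I_d) : exists k : int,
  torus_coord (torus_add h x) j = torus_coord x j + torus_coord h j + k%:~R.
Proof. by rewrite /torus_coord tnth_mktuple; exact: circle_addE. Qed.

Lemma measurable_torus_add d (h : torus R d) : measurable_fun setT (torus_add h).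
Proof.
apply/measurable_fun_tnthP => i; rewrite /comp.
under eq_fun do rewrite tnth_mktuple.
apply: (measurableT_comp (preserves_circle_add _).1).
exact: measurable_tnth.
Qed.

(** Induction on [d]: in dimension [d.+1] the measure is the image of a product under [torus_cons],
    and translations commute with [torus_cons]. *)
Lemma preserves_torus_add d (h : torus R d) :
  preserves (torus_lebesgue R d) (torus_add h).
Proof.
split; first exact: measurable_torus_add.
elim: d h => [|d IH] h A mA.
  suff -> : torus_add h @^-1` A = A by [].
  by apply/seteqP; split => x /=; rewrite (tuple0 (torus_add h x)) (tuple0 x).
rewrite /= /distribution /pushforward.
pose h' : torus R d := [tuple of behead h].
have h'P : preserves (torus_lebesgue R d) (torus_add h').
  by split; [exact: measurable_torus_add|exact: IH].
have [ms sP] := preserves_prod (preserves_circle_add (thead h)) h'P.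
rewrite -[RHS]sP; last first.
  by rewrite -[X in measurable X]setTI; apply: measurable_cons.
rewrite -comp_preimage.
suff -> : torus_add h \o @torus_cons R d =
    @torus_cons R d \o (fun z => (circle_add (thead h) z.1, torus_add h' z.2)) by [].
apply/funext => -[a x] /=; apply: eq_from_tnth => i.
rewrite tnth_mktuple /torus_cons; case: (unliftP ord0 i) => [j ->|->].
  rewrite !tnthS tnth_mktuple tnth_behead; congr (circle_add (tnth _ _) _).
  by apply/val_inj; rewrite /= inordK// ltnS.
by rewrite !tnth0 /thead.
Qed.

End torus_translation.

(** * Characters of the torus and their integrals *)

Section characters.
Variables (R : realType) (d : nat).
Implicit Types (m : 'I_d -> int) (x h : torus R d).

Lemma cosD2pi_int (a : R) (k : int) : cos (a + 2 * pi * k%:~R) = cos a.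
Proof.
have P (n : nat) (b : R) : cos (b + 2 * pi * n%:R) = cos b.
  by rewrite -[RHS](periodicn (@cosD2pi R) n b); congr cos; ring.
case: k => n; first exact: P.
by rewrite -[LHS](P n.+1) NegzE; congr cos; rewrite mulrNz; ring.
Qed.

Lemma sinD2pi_int (a : R) (k : int) : sin (a + 2 * pi * k%:~R) = sin a.
Proof.
have P (n : nat) (b : R) : sin (b + 2 * pi * n%:R) = sin b.
  by rewrite -[RHS](periodicn (@sinD2pi R) n b); congr sin; ring.
case: k => n; first exact: P.
by rewrite -[LHS](P n.+1) NegzE; congr sin; rewrite mulrNz; ring.
Qed.

(** Same formula as [phase], but for any integer vector, since the difference of two frequencies can
    leave the box [{-n, ..., n}^d]. *)
Definition angle m x : R := 2 * pi * \sum_(j < d) (m j)%:~R * torus_coord x j.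

(** Each coordinate is translated up to an integer; weighted by the integers [m j], these
    corrections add up to a whole number of turns. *)
Lemma angle_add m h x : exists k : int,
  angle m (torus_add h x) = angle m x + angle m h + 2 * pi * k%:~R.
Proof.
have [k kE] := choice (torus_coord_add h x).
exists (\sum_(j < d) m j * k j); rewrite /angle rmorph_sum/= -!mulrDr -!big_split/=.
by congr (_ * _); apply: eq_bigr => j _; rewrite kE intrM; ring.
Qed.

Lemma measurable_angle m : measurable_fun [set: torus R d] (angle m).
Proof.
apply: measurable_funM => //; apply: measurable_sum => j.
by apply: measurable_funM => //; exact: measurable_torus_coord.
Qed.

Lemma bounded_measurable_cos m : bounded_measurable (fun x => cos (angle m x)).
Proof.
split; last by exists 1 => x; rewrite ler_norml cos_geN1 cos_le1.
apply: measurableT_comp (measurable_angle m).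
by apply: continuous_measurable_fun; exact: continuous_cos.
Qed.

Lemma bounded_measurable_sin m : bounded_measurable (fun x => sin (angle m x)).
Proof.
split; last by exists 1 => x; rewrite ler_norml sin_geN1 sin_le1.
apply: measurableT_comp (measurable_angle m).
by apply: continuous_measurable_fun; exact: continuous_sin.
Qed.

Lemma torus_lebesgueT : torus_lebesgue R d setT = 1%E.
Proof. by rewrite probability_setT. Qed.

Lemma torus_lebesgue_fin : (torus_lebesgue R d setT < +oo)%E.
Proof. by rewrite probability_setT ltry. Qed.

(* Translating by [h] multiplies the complex number C + iS, where C and S are
   the two integrals, by [s * exp(i * angle m h)], which is not 1. *)
Lemma twisted_integral0 m h (f : torus R d -> R) (s : R) :
  bounded_measurable f -> (forall x, f (torus_add h x) = s * f x) ->
  s * cos (angle m h) != 1 ->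
  Rintegral (torus_lebesgue R d) setT (fun x => f x * cos (angle m x)) = 0 /\
  Rintegral (torus_lebesgue R d) setT (fun x => f x * sin (angle m x)) = 0.
Proof.
move=> bf fh sm.
have bc := bounded_measurableM bf (bounded_measurable_cos m).
have bs := bounded_measurableM bf (bounded_measurable_sin m).
have lin := bounded_functional_comb (bounded_functional_Rintegral torus_lebesgue_fin).
set C := Rintegral _ _ _; set S := Rintegral _ _ _.
set u := cos (angle m h) in sm; set v := sin (angle m h).
have eC : C = s * u * C + - (s * v) * S.
  rewrite {1}/C -(Rintegral_preserves torus_lebesgue_fin (preserves_torus_add h) bc) -lin//.
  apply: eq_Rintegral => x _; have [k ->] := angle_add m h x.
  by rewrite fh cosD2pi_int cosD; rewrite /u /v; ring.
have eS : S = s * u * S + s * v * C.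
  rewrite {1}/S -(Rintegral_preserves torus_lebesgue_fin (preserves_torus_add h) bs) -lin//.
  apply: eq_Rintegral => x _; have [k ->] := angle_add m h x.
  by rewrite fh sinD2pi_int sinD; rewrite /u /v; ring.
(* This is the determinant of the homogeneous linear system satisfied by [C] and [S]; [sm] makes its
   first square positive. *)
have D0 : (1 - s * u) ^+ 2 + (s * v) ^+ 2 != 0.
  rewrite gt_eqF// ltr_wpDr ?sqr_ge0// lt_neqAle sqr_ge0 andbT eq_sym sqrf_eq0.
  by rewrite subr_eq0 eq_sym.
have {eC}eC : (1 - s * u) * C = - (s * v) * S by rewrite mulrBl mul1r {1}eC addrC addKr.
have {eS}eS : (1 - s * u) * S = s * v * C by rewrite mulrBl mul1r {1}eS addrC addKr.
clearbody C S u v; split; apply: (mulfI D0); rewrite mulr0 mulrDl !expr2 -!mulrA.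
  by rewrite eC [s * (v * C)]mulrA -eS; ring.
by rewrite eS [s * (v * S)]mulrA -[s * v]opprK [- - _ * S]mulNr -eC; ring.
Qed.

Definition torus_unit (j : 'I_d) (t : circle R) : torus R d :=
  [tuple if i == j then t else point | i < d].

Lemma torus_coord_unit j t i :
  torus_coord (torus_unit j t) i = if i == j then circle_val t else 0.
Proof. by rewrite /torus_coord tnth_mktuple; case: eqP. Qed.

Lemma angle_unit m j t : angle m (torus_unit j t) = 2 * pi * ((m j)%:~R * circle_val t).
Proof.
rewrite /angle (bigD1 j)//= torus_coord_unit eqxx big1 ?addr0// => i /negPf ij.
by rewrite torus_coord_unit ij mulr0.
Qed.

Lemma half_inv_circle (N : nat) : (0 < N)%N ->
  (0 <= (2 * N%:R)^-1 :> R) && ((2 * N%:R)^-1 < 1 :> R).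
Proof.
move=> N0; have N1 : 1 <= N%:R :> R by rewrite ler1n.
by rewrite invr_ge0 mulr_ge0//= invf_lt1; lra.
Qed.

(** If some [m j] is nonzero, moving coordinate [j] by [1 / (2 |m j|)] changes the angle by plus or
    minus pi, so [twisted_integral0] applies with the constant function 1 and [s = 1]. *)
Lemma integral_character m :
  Rintegral (torus_lebesgue R d) setT (fun x => cos (angle m x)) = [forall j, m j == 0]%:R /\
  Rintegral (torus_lebesgue R d) setT (fun x => sin (angle m x)) = 0.
Proof.
case: (boolP [forall j, m j == 0]) => [/forallP m0|].
  have a0 x : angle m x = 0.
    by rewrite /angle big1 ?mulr0// => j _; rewrite (eqP (m0 j)) mul0r.
  have cstE c : Rintegral (torus_lebesgue R d) setT (fun=> c) = c.
    rewrite Rintegral_cst// -[RHS]mulr1; congr (_ * _).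
    by rewrite -[RHS]/(fine 1%E) -torus_lebesgueT.
  by split; [rewrite -[RHS]cstE|rewrite -[RHS]cstE]; apply: eq_Rintegral => x _;
    rewrite a0 (cos0, sin0).
rewrite negb_forall => /existsP[j mj].
have N0 : (0 < `|m j|)%N by rewrite absz_gt0.
pose h := torus_unit j (Circle (half_inv_circle N0)).
have h1 : 1 * cos (angle m h) != 1.
  have v0 : `|(m j)%:~R| != 0 :> R by rewrite normr_eq0 intr_eq0.
  have -> : cos (angle m h) = -1.
    rewrite angle_unit/= natr_absz intr_norm -cospi.
    have [v1|v1] := lerP 0 ((m j)%:~R : R); rewrite ?(ger0_norm v1) ?(ltr0_norm v1) in v0 *.
      by congr cos; field.
    by rewrite -[in RHS]cosN; congr cos; field; rewrite -oppr_eq0.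
  by rewrite mul1r lt_eqF// ltrN10.
have [] := @twisted_integral0 m h (fun=> 1) 1 (bounded_measurable_cst _ 1) _ h1.
  by move=> x; rewrite mulr1.
by move=> c0 s0; split; [apply: etrans c0|apply: etrans s0];
  apply: eq_Rintegral => x _; rewrite mul1r.
Qed.

End characters.

(** * Lipschitz functions for the wrap-around distance *)

Section lipschitz.
Variables (R : realType) (d : nat).
Implicit Types (x y : torus R d) (f : torus R d -> R).

Lemma torus_dist_le x y (k : 'I_d -> int) :
  torus_dist x y <= \sum_(j < d) `|torus_coord x j - torus_coord y j + (k j)%:~R|.
Proof.
apply: ge_inf; last by exists k.
by exists 0 => _ [l _ <-]; exact: sumr_ge0.
Qed.

Lemma lip1P f : (forall x y (k : 'I_d -> int), `|f x - f y| <=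
    \sum_(j < d) `|torus_coord x j - torus_coord y j + (k j)%:~R|) -> lip1 f.
Proof.
move=> fk x y; apply: lb_le_inf; last by move=> _ [k _ <-]; exact: fk.
by exists (\sum_(j < d) `|torus_coord x j - torus_coord y j + ((fun=> 0) j : int)%:~R|); exists (fun=> 0).
Qed.

Lemma torus_dist_le_sum x y :
  torus_dist x y <= \sum_(j < d) `|torus_coord x j - torus_coord y j|.
Proof.
apply: le_trans (torus_dist_le x y (fun=> 0)) _.
by under eq_bigr do rewrite addr0.
Qed.

(** Coordinates in [[0, 1)] differ by less than 1, so every point is within distance [d] of
    [point]. *)
Lemma lip1_bounded f : lip1 f -> exists B, forall x, `|f x| <= B.
Proof.
move=> lf; exists (`|f point| + d%:R) => x.
have -> : f x = f point + (f x - f point) by ring.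
apply: le_trans (ler_normD _ _) _; rewrite lerD2l.
apply: le_trans (lf _ _) _; apply: le_trans (torus_dist_le_sum _ _) _.
rewrite -[leRHS]mulr1 -[X in _ <= X%:R * _](card_ord d) mulr_natl -sumr_const.
apply: ler_sum => j _; rewrite ler_norml.
by have := circle_valP (tnth x j); have := circle_valP (tnth (point : torus R d) j);
  rewrite /torus_coord => /andP[? ?] /andP[? ?]; lra.
Qed.

(* A torus is covered by grid cells of arbitrarily small diameter, so a strict
   superlevel set is the union of the countably many cells it contains. *)
Lemma measurable_lip1 f : lip1 f -> measurable_fun setT f.
Proof.
move=> lf mT; apply: (measurability _ (RGenOInfty.measurableE R)) => //.
move=> _ [_ [c ->] <-]; rewrite setTI.
pose cell (i : nat * {ffun 'I_d -> nat}) : set (torus R d) :=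
  [set x | forall j, i.1.+1%:R * torus_coord x j \in `[(i.2 j)%:R, (i.2 j).+1%:R[].
have mcell i : measurable (cell i).
  have -> : cell i = \bigcap_(j in [set: 'I_d])
      (setT `&` (fun x => i.1.+1%:R * torus_coord x j) @^-1` `[(i.2 j)%:R, (i.2 j).+1%:R[).
    by apply/seteqP; split=> x /= xi j; [split => //; exact: xi|case: (xi j I)].
  apply: fin_bigcap_measurable => // j _.
  have mj : measurable_fun setT (fun x : torus R d => i.1.+1%:R * torus_coord x j).
    by apply: measurable_funM => //; exact: measurable_torus_coord.
  by apply: mj => //; exact: measurable_itv.
(* Cells that leave the superlevel set are replaced by the empty set, so that the union runs over a
   whole countable type. *)
pose F i := if `[< cell i `<=` [set x | c < f x] >] then cell i else set0.
have -> : f @^-1` `]c, +oo[ = \bigcup_i F i.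
  apply/seteqP; split => x /=; rewrite in_itv/= andbT.
    move=> cfx.
    pose e := f x - c; have e0 : 0 < e by rewrite subr_gt0.
    (* Cells of side [1/(m+1)] have diameter at most [d/(m+1)], which this choice puts below the
       margin [e]. *)
    pose m := Num.trunc (d%:R / e).
    have dm : d%:R < m.+1%:R * e.
      by rewrite -ltr_pdivrMr//; have /andP[] := truncn_itv (divr_ge0 (ler0n R d) (ltW e0)).
    pose k := [ffun j : 'I_d => Num.trunc (m.+1%:R * torus_coord x j)].
    have xk : cell (m, k) x.
      move=> j /=; rewrite in_itv/= ffunE; apply: truncn_itv.
      by rewrite mulr_ge0//; have /andP[] := circle_valP (tnth x j).
    exists (m, k) => //; rewrite /F asboolT// => y yk /=.
    have m0 : 0 < m.+1%:R :> R by rewrite ltr0n.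
    have xy : m.+1%:R * `|f x - f y| <= d%:R.
      apply: le_trans (_ : m.+1%:R * \sum_(j < d) `|torus_coord x j - torus_coord y j| <= _).
        by rewrite ler_pM2l//; apply: le_trans (lf _ _) (torus_dist_le_sum _ _).
      rewrite mulr_sumr -[leRHS]mulr1 -[X in _ <= X%:R * _](card_ord d) mulr_natl -sumr_const.
      apply: ler_sum => j _; rewrite -[X in X * _](ger0_norm (ltW m0)) -normrM mulrBr ler_norml.
      by move: (xk j) (yk j); rewrite /= !in_itv/= -!natr1 => /andP[? ?] /andP[? ?]; lra.
    have : `|f x - f y| < e by rewrite -(ltr_pM2l m0); exact: le_lt_trans xy dm.
    by rewrite ltr_norml /e; lra.
  by move=> [i _]; rewrite /F; case: asboolP => // ci /ci.
apply: countable_bigcupT_measurable => [|i]; first exact: countableP.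
by rewrite /F; case: ifP => // _; exact: measurable0.
Qed.

Lemma bounded_measurable_lip1 f : lip1 f -> bounded_measurable f.
Proof. by move=> lf; split; [exact: measurable_lip1|exact: lip1_bounded]. Qed.

End lipschitz.

(** * Lipschitz bounds for sines and cosines *)

Section trigonometric_lipschitz.
Variables (R : realType) (d : nat).

Lemma ler_dist_cos (a b : R) : `|cos a - cos b| <= `|a - b|.
Proof.
wlog ab : a b / a <= b.
  move=> H; case: (leP a b) => [/H//|/ltW/H].
  by rewrite distrC [leRHS]distrC.
have dcos (c : R) : c \in `]a, b[ -> is_derive c 1 cos (- sin c) by move=> _; exact: is_derive_cos.
have [|c _ E] := MVT_segment ab dcos.
  by apply: continuous_subspaceT; exact: continuous_cos.
by rewrite distrC E normrM normrN [leRHS]distrC ler_piMl// sin_max.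
Qed.

Lemma ler_dist_sin (a b : R) : `|sin a - sin b| <= `|a - b|.
Proof.
wlog ab : a b / a <= b.
  move=> H; case: (leP a b) => [/H//|/ltW/H].
  by rewrite distrC [leRHS]distrC.
have dsin (c : R) : c \in `]a, b[ -> is_derive c 1 sin (cos c) by move=> _; exact: is_derive_sin.
have [|c _ E] := MVT_segment ab dsin.
  by apply: continuous_subspaceT; exact: continuous_sin.
by rewrite distrC E normrM [leRHS]distrC ler_piMl// ler_norml cos_geN1 cos_le1.
Qed.

Lemma lip1_periodic (g : R -> R) (m : 'I_d -> int) (n : nat) :
  (forall a (k : int), g (a + 2 * pi * k%:~R) = g a) ->
  (forall a b, `|g a - g b| <= `|a - b|) ->
  (0 < n)%N -> (forall j, `|m j| <= n%:Z) ->
  lip1 (fun x : torus R d => (2 * pi * n%:R)^-1 * g (angle m x)).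
Proof.
move=> gper glip n0 mn; apply: lip1P => x y k.
have c0 : 0 < 2 * pi * n%:R :> R by rewrite !mulr_gt0 ?pi_gt0 ?ltr0n.
rewrite -mulrBr normrM gtr0_norm ?invr_gt0// mulrC ler_pdivrMr// mulrC.
(* Shifting the coordinates by the integers [k j] adds a whole number of turns to the angle, which
   [g] does not see. *)
rewrite -(gper (angle m x) (\sum_(j < d) m j * k j)).
apply: le_trans (glip _ _) _; rewrite /angle rmorph_sum/= -mulrDr -mulrBr.
rewrite normrM gtr0_norm ?mulr_gt0 ?pi_gt0//. 
rewrite -[leRHS]mulrA ler_pM2l ?mulr_gt0 ?pi_gt0//.
rewrite -big_split/= -sumrB mulr_sumr.
apply: le_trans (ler_norm_sum _ _ _) _; apply: ler_sum => j _.
rewrite intrM -!mulrDr -mulrBr normrM addrAC ler_wpM2r//.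
by rewrite -intr_norm -[n%:R]/(n%:Z%:~R) ler_int.
Qed.

End trigonometric_lipschitz.

(** * Real and imaginary parts of complex sums *)

Section complex_sums.
Variable R : realType.

Lemma Re_sum_mul (I : finType) (p z : I -> R[i]) :
  complex.Re (\sum_i p i * z i) =
  \sum_i (complex.Re (p i) * complex.Re (z i) - complex.Im (p i) * complex.Im (z i)).
Proof.
elim/big_rec2 : _ => //= i a w _ <-.
by case: (p i) (z i) w => [u v] [u' v'] [w1 w2].
Qed.

Lemma Im_sum_mul (I : finType) (p z : I -> R[i]) :
  complex.Im (\sum_i p i * z i) =
  \sum_i (complex.Re (p i) * complex.Im (z i) + complex.Im (p i) * complex.Re (z i)).
Proof.
elim/big_rec2 : _ => //= i a w _ <-.
by case: (p i) (z i) w => [u v] [u' v'] [w1 w2].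
Qed.

Lemma normc_ReIm (z : R[i]) :
  Normc.normc z = Num.sqrt (complex.Re z ^+ 2 + complex.Im z ^+ 2).
Proof. by case: z. Qed.

Lemma ler_Re_normc (z : R[i]) : `|complex.Re z| <= Normc.normc z.
Proof. by rewrite normc_ReIm -sqrtr_sqr ler_wsqrtr// lerDl sqr_ge0. Qed.

Lemma ler_Im_normc (z : R[i]) : `|complex.Im z| <= Normc.normc z.
Proof. by rewrite normc_ReIm -sqrtr_sqr ler_wsqrtr// lerDr sqr_ge0. Qed.

End complex_sums.

(** * Minimising a supremum of moduli of affine functions *)

Section best_approximation.
Variables (R : realType) (K : finType) (U : Type) (L : set U).
Variables (z : U -> K -> R[i]) (c : U -> R[i]).

(** Abstract form of the integral of a test function [f] against [p dx - mu]: [z f k] stands for the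
    integral of [f] times the [k]-th exponential, [c f] for the integral of [f] against [mu]. *)
Definition residual (p : {ffun K -> R[i]}) (f : U) : R[i] :=
  \sum_k p k * z f k - c f.

Definition sup_residual (p : {ffun K -> R[i]}) : \bar R :=
  ereal_sup [set (Normc.normc (residual p f))%:E | f in L].

Hypothesis L0 : L !=set0.
Hypothesis coercive : forall (M : R) (k : K), exists B : R,
  forall p, (forall f, L f -> Normc.normc (residual p f) <= M) ->
  `|complex.Re (p k)| <= B /\ `|complex.Im (p k)| <= B.

Let N := #|{: K * bool}|.

(** Coefficient families become real row vectors with two entries per index, where closed boxes are
    compact. *)
Let coeffs (v : 'rV[R]_N) : {ffun K -> R[i]} :=
  [ffun k => Complex (v ord0 (enum_rank (k, true))) (v ord0 (enum_rank (k, false)))].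

Let coords (p : {ffun K -> R[i]}) : 'rV[R]_N :=
  \row_i (let: (k, b) := enum_val i in if b then complex.Re (p k) else complex.Im (p k)).

Let coordsK p : coeffs (coords p) = p.
Proof.
by apply/ffunP => k; rewrite ffunE !mxE !enum_rankK; case: (p k).
Qed.

Let continuous_sumr (I : Type) (s : seq I) (F : I -> 'rV[R]_N -> R) :
  (forall i, continuous (F i)) -> continuous (fun v => \sum_(i <- s) F i v).
Proof.
move=> cF; elim: s => [|i s IH].
  rewrite (_ : (fun v => _) = (fun=> 0)); first exact: cst_continuous.
  by apply/funext => v; rewrite big_nil.
rewrite (_ : (fun v => _) = (fun v => F i v + \sum_(j <- s) F j v)).
  by move=> v; exact: (continuousD (cF i v) (IH v)).
by apply/funext => v; rewrite big_cons.
Qed.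

Let continuous_normc_residual f :
  continuous (fun v => Normc.normc (residual (coeffs v) f)).
Proof.
have cRe k : continuous (fun v => complex.Re (coeffs v k)).
  rewrite (_ : (fun v : 'rV[R]_N => _) = (fun v : 'rV[R]_N => v ord0 (enum_rank (k, true)))); last first.
    by apply/funext => v; rewrite ffunE.
  exact: coord_continuous.
have cIm k : continuous (fun v => complex.Im (coeffs v k)).
  rewrite (_ : (fun v : 'rV[R]_N => _) = (fun v : 'rV[R]_N => v ord0 (enum_rank (k, false)))); last first.
    by apply/funext => v; rewrite ffunE.
  exact: coord_continuous.
have cc (a : R) : continuous (fun _ : 'rV[R]_N => a) by exact: cst_continuous.
have cRes : continuous (fun v => complex.Re (residual (coeffs v) f)).
  rewrite (_ : (fun v => _) = (fun v => \sum_k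
      (complex.Re (coeffs v k) * complex.Re (z f k) -
       complex.Im (coeffs v k) * complex.Im (z f k)) - complex.Re (c f))); last first.
    apply/funext => v; rewrite -Re_sum_mul /residual.
    by case: (\sum_k _) (c f) => [? ?] [].
  move=> v; apply: (fun H => continuousB (H v) (cc _ v)).
  apply: continuous_sumr => k w.
  exact: (continuousB (continuousM (cRe k w) (cc _ w)) (continuousM (cIm k w) (cc _ w))).
have cIms : continuous (fun v => complex.Im (residual (coeffs v) f)).
  rewrite (_ : (fun v => _) = (fun v => \sum_k
      (complex.Re (coeffs v k) * complex.Im (z f k) +
       complex.Im (coeffs v k) * complex.Re (z f k)) - complex.Im (c f))); last first.
    apply/funext => v; rewrite -Im_sum_mul /residual.
    by case: (\sum_k _) (c f) => [? ?] [].
  move=> v; apply: (fun H => continuousB (H v) (cc _ v)).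
  apply: continuous_sumr => k w.
  exact: (continuousD (continuousM (cRe k w) (cc _ w)) (continuousM (cIm k w) (cc _ w))).
rewrite (_ : (fun v => _) = Num.sqrt \o (fun v =>
    complex.Re (residual (coeffs v) f) * complex.Re (residual (coeffs v) f) +
    complex.Im (residual (coeffs v) f) * complex.Im (residual (coeffs v) f))).
  move=> v; apply: continuous_comp; last exact: sqrt_continuous.
  exact: (continuousD (continuousM (cRes v) (cRes v)) (continuousM (cIms v) (cIms v))).
by apply/funext => v; rewrite /= normc_ReIm !expr2.
Qed.

Let sublevel (M : R) : set 'rV[R]_N :=
  [set v | forall f, L f -> Normc.normc (residual (coeffs v) f) <= M].

Let closed_sublevel M : closed (sublevel M).
Proof.
have -> : sublevel M = \bigcap_(f in L)
    ((fun v => Normc.normc (residual (coeffs v) f)) @^-1` [set x | x <= M]).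
  by apply/seteqP; split => v vM f Lf; exact: vM.
apply: closed_bigI => f Lf; apply: preimage_closed; last exact: closed_le.
by move=> v _; exact: continuous_normc_residual.
Qed.

(** Approximate minimizers eventually stay in a compact box, and a cluster point lies in every
    closed sublevel set above the infimum. *)
Lemma sup_residual_attained : exists p,
  sup_residual p = ereal_inf [set sup_residual q | q in [set: {ffun K -> R[i]}]].
Proof.
set r := ereal_inf _.
have [f0 Lf0] := L0.
have ler p : (r <= sup_residual p)%E by apply: ereal_inf_lbound; exists p.
(* A single test function bounds all values below by a modulus, which rules out the infimum
   [-oo]. *)
have r0 : (0 <= r)%E.
  apply: le_ereal_inf_tmp => _ [p _ <-].
  apply: le_trans (_ : ((Normc.normc (residual p f0))%:E <= _)%E); last first.
    by apply: ereal_sup_ubound; exists f0.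
  by rewrite lee_fin normc_ReIm sqrtr_ge0.
case rE : r r0 => [s| |] // r0; last first.
(* If the infimum is [+oo], so is every value, and the zero family serves. *)
- by exists [ffun=> 0]; apply/eqP; rewrite eq_le leey -{1}rE ler.
have near_inf (m : nat) : exists v, sublevel (s + m.+1%:R^-1) v.
  have /(@ereal_inf_lt R)[_ [p _ <-] pm] : (r < (s + m.+1%:R^-1)%:E)%E.
    by rewrite rE lte_fin ltrDl invr_gt0 ltr0n.
  exists (coords p) => f Lf; rewrite coordsK -lee_fin.
  by apply: le_trans (ltW pm); apply: ereal_sup_ubound; exists f.
have [u uP] := choice near_inf.
have uM e : 0 < e -> \forall m \near \oo, sublevel (s + e) (u m).
  move=> e0; near=> m => f Lf; apply: le_trans (uP m f Lf) _; rewrite lerD2l.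
  by apply: ltW; near: m; exact: (near_infty_natSinv_lt (PosNum e0)).
have coord_bound (i : 'I_N) : exists b : R, forall w : 'rV[R]_N,
    sublevel (s + 1) w -> `|w ord0 i| <= b.
  case: (enum_val i) (enum_valK i) => k b <-.
  have [B BP] := coercive (s + 1) k; exists B => w /BP[]; rewrite ffunE/=.
  by case: b.
have [B BP] := choice coord_bound.
have cpt : compact [set v : 'rV[R]_N | forall i, v ord0 i \in `[- B i, B i]].
  by apply: (@rV_compact _ _ (fun i => `[- B i, B i]%classic)) => i; exact: segment_compact.
have box : \forall m \near \oo, forall i, u m ord0 i \in `[- B i, B i].
  apply: filterS (uM 1 ltr01) => m um i.
  by rewrite in_itv/= -ler_norml; exact: BP.
have [v [_ vcl]] := cpt (u @ \oo) _ box.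
exists (coeffs v); apply/eqP; rewrite eq_le -{2}rE ler andbT.
apply: ge_ereal_sup => _ [f Lf <-]; rewrite lee_fin; apply/ler_addgt0Pr => e e0.
(* A tail of [u] lies in this sublevel set, so the cluster point [v] is in its closure. *)
suff : closure (sublevel (s + e)) v by move/(@closed_sublevel (s + e)); apply.
by move=> C vC; exact: vcl (uM e e0) vC.
Unshelve. all: by end_near. Qed.

End best_approximation.

(** * Fourier moments, recovery of coefficients, and existence of a best approximation *)

Section trigpoly_moments.
Variables (R : realType) (d n : nat).
Implicit Types (p : trigpoly R d n) (f : torus R d -> R) (k l : trig_index d n).

Local Notation lambda := (torus_lebesgue R d).

(** The integral of [f] times [exp(2 pi i m x)], i.e. the Fourier coefficient of [f] at frequency
    [-m]. *)
Definition moment f (m : 'I_d -> int) : R[i] :=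
  Complex (Rintegral lambda setT (fun x => f x * cos (angle m x)))
          (Rintegral lambda setT (fun x => f x * sin (angle m x))).

Lemma bounded_measurable_Re_trigpoly p :
  bounded_measurable (fun x => complex.Re (trigpoly_fun p x)).
Proof.
under [X in bounded_measurable X]eq_fun do rewrite Re_trigpoly.
by apply: bounded_measurable_sum => k; apply: bounded_measurableB;
  apply: bounded_measurableZ; [exact: bounded_measurable_cos|exact: bounded_measurable_sin].
Qed.

Lemma bounded_measurable_Im_trigpoly p :
  bounded_measurable (fun x => complex.Im (trigpoly_fun p x)).
Proof.
under [X in bounded_measurable X]eq_fun do rewrite Im_trigpoly.
by apply: bounded_measurable_sum => k; apply: bounded_measurableD;
  apply: bounded_measurableZ; [exact: bounded_measurable_sin|exact: bounded_measurable_cos].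
Qed.

Lemma cmeasure_integral_trigpoly p f : bounded_measurable f ->
  cmeasure_integral (trigpoly_measure p) f = \sum_k p k * moment f (freq k).
Proof.
move=> bf.
have blam := bounded_functional_Rintegral (torus_lebesgue_fin R d).
have bc k := bounded_measurableM bf (bounded_measurable_cos R (freq k)).
have bs k := bounded_measurableM bf (bounded_measurable_sin R (freq k)).
apply/eqP; rewrite eq_complex; apply/andP; split; apply/eqP.
  rewrite Re_sum_mul /= charge_integral_induced//; last 2 first.
  - exact: torus_lebesgue_fin.
  - exact: bounded_measurable_Re_trigpoly.
  (* The factor 1 gives the sum the shape expected by [bounded_functional_sum]. *)
  transitivity (Rintegral lambda setT (fun x => \sum_k (1 *
      (complex.Re (p k) * (f x * cos (angle (freq k) x)) +
       - complex.Im (p k) * (f x * sin (angle (freq k) x)))))).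
    apply: eq_Rintegral => x _; rewrite Re_trigpoly mulr_sumr.
    by apply: eq_bigr => k _; rewrite /phase -/(angle (freq k) x); ring.
  rewrite bounded_functional_sum//.
    by apply: eq_bigr => k _; rewrite bounded_functional_comb// mul1r mulNr.
  by move=> k; apply: bounded_measurableD; exact: bounded_measurableZ.
rewrite Im_sum_mul /= charge_integral_induced//; last 2 first.
- exact: torus_lebesgue_fin.
- exact: bounded_measurable_Im_trigpoly.
transitivity (Rintegral lambda setT (fun x => \sum_k (1 *
    (complex.Re (p k) * (f x * sin (angle (freq k) x)) +
     complex.Im (p k) * (f x * cos (angle (freq k) x)))))).
  apply: eq_Rintegral => x _; rewrite Im_trigpoly mulr_sumr.
  by apply: eq_bigr => k _; rewrite /phase -/(angle (freq k) x); ring.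
rewrite bounded_functional_sum//.
  by apply: eq_bigr => k _; rewrite bounded_functional_comb// mul1r.
by move=> k; apply: bounded_measurableD; exact: bounded_measurableZ.
Qed.

Lemma normr_freq_le k j : `|freq k j| <= n%:Z.
Proof.
have := ltn_ord (k j); rewrite /freq; move: (k j : nat) => a; rewrite ltnS -addnn => an.
by rewrite ler_norml; lia.
Qed.

Lemma freq_inj k l : (forall j, freq k j = freq l j) -> k = l.
Proof.
move=> kl; apply/ffunP => j; apply: val_inj; apply/eqP; rewrite -eqz_nat.
by apply/eqP; have := kl j; rewrite /freq; apply: addIr.
Qed.

(** The scaling that makes the cosines and sines of degree at most [n] 1-Lipschitz. *)
Let kappa : R := (2 * pi * n%:R)^-1.
Let fcos k x : R := kappa * cos (angle (freq k) x).
Let fsin k x : R := kappa * sin (angle (freq k) x).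

(** The combination [fcos k - i fsin k] is [kappa * exp(-2 pi i k x)], so this is orthogonality of
    characters, applied to the frequency difference [l - k]. *)
Lemma moment_orthogonality k l :
  moment (fcos k) (freq l) - 'i%C * moment (fsin k) (freq l) = (kappa * (k == l)%:R)%:C%C.
Proof.
have blam := bounded_functional_comb (bounded_functional_Rintegral (torus_lebesgue_fin R d)).
have bc m := bounded_measurable_cos R (m : 'I_d -> int).
have bs m := bounded_measurable_sin R (m : 'I_d -> int).
pose m j := freq l j - freq k j.
have mE (x : torus R d) : angle m x = angle (freq l) x - angle (freq k) x.
  rewrite /angle -mulrBr -sumrB; congr (_ * _); apply: eq_bigr => j _.
  by rewrite /m intrB; ring.
have [cE sE] := integral_character R m.
have b0 : [forall j, m j == 0] = (k == l).
  apply/forallP/eqP => [mj|kl j]; last by rewrite /m kl subrr.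
  by apply: freq_inj => j; apply/esym/eqP; rewrite -subr_eq0; exact: mj.
have kb h : bounded_measurable h -> bounded_measurable (fun x : torus R d => kappa * h x).
  exact: bounded_measurableZ.
have comb (F G H : torus R d -> R) b : bounded_measurable F -> bounded_measurable G ->
    bounded_measurable H -> (forall x, F x + b * G x = kappa * H x) ->
    Rintegral lambda setT F + b * Rintegral lambda setT G =
    kappa * Rintegral lambda setT H.
  move=> bF bG bH FGH.
  rewrite -[Rintegral _ _ F]mul1r -[RHS]addr0 -[0 in RHS](mul0r (Rintegral lambda setT H)).
  by rewrite -!blam//; apply: eq_Rintegral => x _; rewrite mul1r FGH mul0r addr0.
apply/eqP; rewrite eq_complex /=; apply/andP; split; apply/eqP.
  rewrite !(mul0r, mul1r) sub0r opprK -b0 -cE -[X in _ + X]mul1r.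
  apply: comb => //; try by apply: bounded_measurableM => //; exact: kb.
  by move=> x; rewrite mE cosD cosN sinN /fcos /fsin; ring.
rewrite !(mul0r, mul1r) add0r -[RHS](mulr0 kappa) -sE -mulN1r.
apply: comb => //; try by apply: bounded_measurableM => //; exact: kb.
by move=> x; rewrite mE sinD cosN sinN /fcos /fsin; ring.
Qed.

(** Test functions are real, so a coefficient is recovered from two of them, combined with the
    factor [-i]. *)
Lemma coefficient_moments p k :
  \sum_l p l * moment (fcos k) (freq l) - 'i%C * \sum_l p l * moment (fsin k) (freq l)
  = kappa%:C%C * p k.
Proof.
rewrite mulr_sumr -sumrB (bigD1 k)//= big1 ?addr0.
  by rewrite mulrCA -mulrBr moment_orthogonality eqxx mulr1 mulrC.
move=> l /negPf lk.
by rewrite mulrCA -mulrBr moment_orthogonality eq_sym lk mulr0 mulr0.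
Qed.

Lemma W1_trigpolyE p (mu : complex_measure (torus R d) R) :
  W1_trigpoly p mu = sup_residual [set f | lip1 f]
    (fun f l => moment f (freq l)) (cmeasure_integral mu) p.
Proof.
congr ereal_sup; apply: eq_imagel => f lf.
have bf := bounded_measurable_lip1 lf.
by rewrite cmeasure_integral_sub// cmeasure_integral_trigpoly.
Qed.

Lemma W1_inf_attained (mu : complex_measure (torus R d) R) : (0 < n)%N ->
  exists p : trigpoly R d n, W1_trigpoly p mu = W1_inf n mu.
Proof.
move=> n0; pose z (f : torus R d -> R) l := moment f (freq l).
pose c := cmeasure_integral mu.
have kappa0 : 0 < kappa by rewrite invr_gt0 !mulr_gt0 ?pi_gt0 ?ltr0n.
have [|M k|p pE] := @sup_residual_attained R (trig_index d n) (torus R d -> R)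
  [set f | lip1 f] z c; last 1 first.
- exists p; rewrite W1_trigpolyE pE /W1_inf; congr ereal_inf.
  by apply: eq_imagel => q _; rewrite W1_trigpolyE.
- exists (fun=> 0); apply: lip1P => x y k; rewrite subrr normr0.
  exact: sumr_ge0.
have lc : lip1 (fcos k).
  exact: (lip1_periodic (@cosD2pi_int R) (@ler_dist_cos R) n0 (normr_freq_le k)).
have ls : lip1 (fsin k).
  exact: (lip1_periodic (@sinD2pi_int R) (@ler_dist_sin R) n0 (normr_freq_le k)).
(* One [M] for each of the two tests, plus the integrals of both tests against [mu], divided by
   [kappa]. *)
exists (kappa^-1 * (M + M + (`|complex.Re (c (fcos k))| + `|complex.Im (c (fcos k))| +
  `|complex.Re (c (fsin k))| + `|complex.Im (c (fsin k))|))) => p pM.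
have := coefficient_moments p k.
have := pM _ lc; have := pM _ ls.
rewrite /residual /z; set X := \sum_l _ * moment (fcos k) _; set Y := \sum_l _ * moment (fsin k) _.
move=> YM XM.
have := ler_Re_normc (Y - c (fsin k)); have := ler_Im_normc (Y - c (fsin k)).
have := ler_Re_normc (X - c (fcos k)); have := ler_Im_normc (X - c (fcos k)).
move: YM XM.
case: (X) (Y) (c (fcos k)) (c (fsin k)) (p k) => [x1 x2] [y1 y2] [a1 a2] [b1 b2] [p1 p2].
move: (Normc.normc _) (Normc.normc _) => nY nX nYM nXM /= Xi Xr Yi Yr.
move=> /eqP; rewrite eq_complex /= => /andP[/eqP Er /eqP Ei].
have kappaV (q W : R) : `|kappa * q| <= W -> `|q| <= kappa^-1 * W.
  by rewrite normrM gtr0_norm// mulrC -ler_pdivlMr// mulrC.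
have tri (a b e h s t : R) : `|a - e| <= s -> `|b - h| <= t ->
    `|a + b| <= s + t + (`|e| + `|h|).
  move=> /ler_normlP[? ?] /ler_normlP[? ?].
  have := ler_norm e; have := ler_norm h; have := ler_norm (- e); have := ler_norm (- h).
  by rewrite !normrN ler_norml; lra.
have a1n := normr_ge0 a1; have a2n := normr_ge0 a2.
have b1n := normr_ge0 b1; have b2n := normr_ge0 b2.
split; apply: kappaV.
  (* Since [kappa * p k = X - i Y], its real part is [x1 + y2] and its imaginary part [x2 - y1]. *)
  have -> : kappa * p1 = x1 + y2 by move: Er; lra.
  by apply: le_trans (tri _ _ _ _ _ _ (le_trans Xr nXM) (le_trans Yi nYM)) _; lra.
have -> : kappa * p2 = x2 + - y1 by move: Ei; lra.
apply: le_trans (tri _ _ _ (- b1) _ _ (le_trans Xi nXM) (_ : `|- y1 - - b1| <= M)) _.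
  by rewrite -opprD normrN; exact: le_trans Yr nYM.
by rewrite normrN; lra.
Qed.

End trigpoly_moments.

(** * Distance to the nearest integer *)

Section distance_to_integers.
Variable R : realType.
Implicit Types s t : R.

Definition int_dist t : R := `|t - (Num.floor (t + 2^-1))%:~R|.

Lemma int_dist_le_half t : int_dist t <= 2^-1.
Proof.
have := floor_le_tmp (t + 2^-1); have := floorD1_gt (t + 2^-1).
by rewrite /int_dist intrD ler_norml; lra.
Qed.

(** Distinct integers are at least 1 apart, so any [l] other than [k] is at distance at least 1/2
    from [t]. *)
Lemma nearest_int t (k l : int) : `|t - k%:~R| <= 2^-1 -> `|t - k%:~R| <= `|t - l%:~R|.
Proof.
move=> tk; have [->//|kl] := eqVneq k l.
have kl1 : 1 <= `|k%:~R - l%:~R| :> R.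
  by rewrite -intrB -intr_norm ler1z -gtz0_ge1 normr_gt0 subr_eq0.
have := ler_distD t (k%:~R : R) l%:~R; rewrite [`|k%:~R - t|]distrC; lra.
Qed.

Lemma int_distE t (k : int) : `|t - k%:~R| <= 2^-1 -> int_dist t = `|t - k%:~R|.
Proof.
move=> tk; apply/eqP; rewrite eq_le nearest_int//; last exact: int_dist_le_half.
exact: nearest_int.
Qed.

Lemma int_dist_antiperiodic t (k : int) : int_dist (t + 2^-1 + k%:~R) = 2^-1 - int_dist t.
Proof.
have := int_dist_le_half t; rewrite /int_dist; set l := Num.floor _ => tl.
(* The integer nearest to the shifted point is [l + k + 1] when [t] is to the right of [l] or equal
   to it, and [l + k] when [t] is to the left. *)
have [t0|t0] := leP 0 (t - l%:~R).
  have E : `|t + 2^-1 + k%:~R - (l + k + 1)%:~R| = 2^-1 - `|t - l%:~R|.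
    by rewrite !(ger0_norm t0) in tl *; rewrite !intrD ler0_norm; lra.
  by rewrite -/(int_dist _) (int_distE (k := l + k + 1)) E//; have := normr_ge0 (t - l%:~R); lra.
have E : `|t + 2^-1 + k%:~R - (l + k)%:~R| = 2^-1 - `|t - l%:~R|.
  by rewrite !(ltr0_norm t0) in tl *; rewrite !intrD ger0_norm; lra.
by rewrite -/(int_dist _) (int_distE (k := l + k)) E//; have := normr_ge0 (t - l%:~R); lra.
Qed.

(** The integer nearest to [t], moved by [-l], is a competitor for [s]. *)
Lemma int_dist_lipschitz s t (l : int) : int_dist s <= int_dist t + `|s - t + l%:~R|.
Proof.
set k := Num.floor (t + 2^-1).
apply: le_trans (nearest_int (k - l) (int_dist_le_half s)) _.
rewrite /int_dist -/k intrB.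
have -> : s - (k%:~R - l%:~R) = (t - k%:~R) + (s - t + l%:~R) by ring.
exact: ler_normD.
Qed.

End distance_to_integers.

(** * The tent function and the Dirac measure *)

Section lower_bound.
Variables (R : realType) (d n : nat) (j0 : 'I_d).

(** The constant 1/4 is the midpoint of the range [[0, 1/2]] of [int_dist], which makes the
    half-period shift a sign change. *)
Definition tent (x : torus R d) : R :=
  n.+1%:R^-1 * (4^-1 - int_dist (n.+1%:R * torus_coord x j0)).

Lemma lip1_tent : lip1 tent.
Proof.
apply: lip1P => x y k.
have N0 : 0 < n.+1%:R :> R by rewrite ltr0n.
rewrite /tent -mulrBr normrM gtr0_norm ?invr_gt0// mulrC ler_pdivrMr//.
(* Dilation by [n.+1] turns the shift [k j0] into [n.+1 * k j0], still an integer; both orders are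
   needed for the absolute value. *)
have xy := int_dist_lipschitz (n.+1%:R * torus_coord x j0) (n.+1%:R * torus_coord y j0) (n.+1%:Z * k j0).
have yx := int_dist_lipschitz (n.+1%:R * torus_coord y j0) (n.+1%:R * torus_coord x j0) (- (n.+1%:Z * k j0)).
set u := int_dist _ in xy yx *; set w := int_dist _ in xy yx *.
have -> : 4^-1 - u - (4^-1 - w) = w - u by ring.
apply: le_trans (_ : n.+1%:R * `|torus_coord x j0 - torus_coord y j0 + (k j0)%:~R| <= _); last first.
  rewrite mulrC ler_pM2r// (bigD1 j0)//= lerDl; exact: sumr_ge0.
rewrite -[X in _ <= X * _](gtr0_norm N0) -normrM.
move: xy yx; rewrite mulrNz intrM.
have -> : n.+1%:R * torus_coord x j0 - n.+1%:R * torus_coord y j0 + n.+1%:~R * (k j0)%:~R =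
  n.+1%:R * (torus_coord x j0 - torus_coord y j0 + (k j0)%:~R) by ring.
have -> : n.+1%:R * torus_coord y j0 - n.+1%:R * torus_coord x j0 - n.+1%:~R * (k j0)%:~R =
  - (n.+1%:R * (torus_coord x j0 - torus_coord y j0 + (k j0)%:~R)) by ring.
rewrite normrN; set e := `|_| => xy yx.
by rewrite ler_norml; lra.
Qed.

Lemma cos_neqN1 (t : R) : `|t| < pi -> cos t != -1.
Proof.
move=> tpi; have -> : cos t = cos `|t| by case: (ger0P t) => // _; rewrite cosN.
rewrite gt_eqF// -cospi ltr_cos// in_itv/= ?normr_ge0 ?(ltW tpi)//.
by rewrite lexx pi_ge0.
Qed.

Lemma moment_tent (k : trig_index d n) : moment tent (freq k) = 0.
Proof.
have N0 : 0 < n.+1%:R :> R by rewrite ltr0n.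
pose h : torus R d := torus_unit j0 (Circle (half_inv_circle R (ltn0Sn n))).
have th x : tent (torus_add h x) = -1 * tent x.
  rewrite /tent; have [l ->] := torus_coord_add h x j0.
  rewrite torus_coord_unit eqxx /=.
  have -> : n.+1%:R * (torus_coord x j0 + (2 * n.+1%:R)^-1 + l%:~R) =
    n.+1%:R * torus_coord x j0 + 2^-1 + (n.+1%:Z * l)%:~R :> R.
    by rewrite intrM; field; rewrite gt_eqF.
  rewrite int_dist_antiperiodic; set u := int_dist _.
  by rewrite mulN1r -mulrN; congr (_ * _); lra.
have hm : -1 * cos (angle (freq k) h) != 1.
  rewrite mulN1r eqr_oppLR cos_neqN1// angle_unit/=.
  (* Since [|freq k j0| <= n < n.+1], this angle is strictly between -pi and pi, where the cosine
     avoids -1. *)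
  have -> : 2 * pi * ((freq k j0)%:~R * (2 * n.+1%:R)^-1) = pi * ((freq k j0)%:~R / n.+1%:R) :> R.
    by field; rewrite gt_eqF.
  rewrite normrM gtr0_norm ?pi_gt0// gtr_pMr ?pi_gt0// normrM normfV (gtr0_norm N0).
  rewrite ltr_pdivrMr// mul1r -intr_norm -[n.+1%:R]/(n.+1%:Z%:~R) ltr_int.
  by rewrite (le_lt_trans (normr_freq_le k j0))// ltz_nat.
by rewrite /moment; have [-> ->] := twisted_integral0 (bounded_measurable_lip1 lip1_tent) th hm.
Qed.

Definition dirac_cmeasure (a : torus R d) : complex_measure (torus R d) R :=
  ComplexMeasure (charge_of_finite_measure (dirac a)) czero.

Lemma normalized_dirac a : normalized_cmeasures (dirac_cmeasure a).
Proof.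
have nE A : Normc.normc (dirac_cmeasure a A) = \1_A a.
  by rewrite normc_ReIm/= expr0n/= addr0 sqrtr_sqr ger0_norm.
split; last by rewrite -[RHS]/(Complex 1 0); congr Complex; rewrite [fine _]indicE in_setT.
apply: le_lt_trans (ltry 1); apply: ge_ereal_sup => _ [m [F [mF tF _ ->]]].
rewrite lee_fin; under eq_bigr do rewrite nE.
(* At most one of the disjoint sets contains [a], so the total variation is at most 1. *)
have [[i Fi]|nF] := pselect (exists i, F i a).
  rewrite (bigD1 i)//= big1 ?addr0.
    by rewrite indicE; case: (a \in F i).
  move=> l li; rewrite indicE memNset// => Fl; move/negP: li; apply; apply/eqP.
  by apply: tF => //; exists a.
rewrite big1// => i _; rewrite indicE memNset// => Fi; apply: nF; by exists i.
Qed.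

(** Evaluation at [a] and the zero functional are bounded functionals with the right values on
    indicators. *)
Lemma cmeasure_integral_dirac a f : bounded_measurable f ->
  cmeasure_integral (dirac_cmeasure a) f = (f a)%:C%C.
Proof.
move=> bf; congr Complex.
  move: f bf; apply: bounded_functional_ext.
  - exact: bounded_functional_charge_integral.
  - by split=> //; exists 1 => f c _ fc; rewrite mul1r.
  by move=> A mA; rewrite charge_integral_indic.
move: f bf; apply: bounded_functional_ext.
- exact: bounded_functional_charge_integral.
- split; first by move=> *; rewrite mulr0 addr0.
  by exists 0 => f c _ _; rewrite normr0 mul0r.
by move=> A mA; rewrite charge_integral_indic.
Qed.

Lemma W1_dirac_ge (p : trigpoly R d n) :
  (((4 * n.+1%:R)^-1)%:E <= W1_trigpoly p (dirac_cmeasure (torus_unit j0 point)))%E.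
Proof.
rewrite W1_trigpolyE; apply: ereal_sup_ubound.
exists tent; first exact: lip1_tent.
(* The polynomial contributes nothing, so only the value of the tent at the origin remains. *)
congr EFin; rewrite /residual big1 ?sub0r; last by move=> k _; rewrite moment_tent mulr0.
rewrite cmeasure_integral_dirac; last exact/bounded_measurable_lip1/lip1_tent.
rewrite normc_ReIm/= oppr0 expr0n/= addr0 sqrtr_sqr normrN /tent torus_coord_unit eqxx mulr0.
rewrite (int_distE (k := 0)) subrr normr0 ?invr_ge0// subr0 ger0_norm.
  by rewrite invfM mulrC.
by rewrite mulr_ge0 ?invr_ge0.
Qed.

End lower_bound.

Theorem theorem2p2 (R : realType) (d n : nat) (d_gt0 : (0 < d)%N)
    (n_gt0 : (0 < n)%N) :
  (forall mu : complex_measure (torus R d) R, normalized_cmeasures mu ->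
     exists p : trigpoly R d n, W1_trigpoly p mu = W1_inf n mu) /\
  (((4 * n.+1%:R)^-1 : R)%:E <=
     ereal_sup [set W1_inf n mu | mu in @normalized_cmeasures R d])%E.
Proof.
split=> [mu _|]; first exact: W1_inf_attained.
(* As [point] is 0 on the circle, [mu0] is the Dirac measure at the origin, where the tent peaks. *)
pose j0 := Ordinal d_gt0; pose mu0 := dirac_cmeasure (torus_unit j0 (point : circle R)).
apply: le_trans (_ : (_ <= W1_inf n mu0)%E) _.
  by apply: le_ereal_inf_tmp => _ [p _ <-]; exact: W1_dirac_ge.
by apply: ereal_sup_ubound; exists mu0 => //; exact: normalized_dirac.
Qed.
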